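(* For $\alpha\in\mathbb{N}_0$ and $\lambda,\eta,\delta\in\mathbb{C}$, the following formula holds for all $n\in\mathbb{N}$: $$\frac{\partial}{\partial x_1}\,{}_{\mathfrak{B}}\mathcal{F}_n^{(\alpha)}(x_1,x_2;\lambda;\eta,\delta)=n\;{}_{\mathfrak{B}}\mathcal{F}_{n-1}^{(\alpha)}(x_1,x_2;\lambda;\eta,\delta).$$
   Context: $\mathbb{N}$ is the set of natural numbers, $\mathbb{N}_0$ the set of non-negative integers, $\mathbb{C}$ the set of complex numbers; $x_1,x_2$ are variables. For $\alpha\in\mathbb{N}_0$ and $\lambda,\eta,\delta\in\mathbb{C}$, the Bell based Apostol type polynomials ${}_{\mathfrak{B}}\mathcal{F}_n^{(\alpha)}(x_1,x_2;\lambda;\eta,\delta)$ of order $\alpha$ are defined by the generating function $$\sum_{n\ge 0}{}_{\mathfrak{B}}\mathcal{F}_n^{(\alpha)}(x_1,x_2;\lambda;\eta,\delta)\frac{t^n}{n!}=\left(\frac{2^{\eta}t^{\delta}}{\lambda e^{t}+1}\right)^{\alpha}e^{x_1t+x_2(e^t-1)},\qquad |t|<|\log(-\lambda)|.$$ *)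

(* Defs.v *)
From Stdlib Require Import Reals Factorial Lra.
From Coquelicot Require Import Coquelicot.

Local Open Scope C_scope.

Definition Cexp (z : C) : C := (exp (Re z) * cos (Im z), exp (Re z) * sin (Im z))%R.

(* Principal argument, with values in (-PI, PI] for z <> 0. *)
Definition Carg (z : C) : R :=
  if Rle_dec 0 (Im z) then acos (Re z / Cmod z) else (- acos (Re z / Cmod z))%R.

(* Principal logarithm; the value at 0 is junk and is never used below. *)
Definition Clog (z : C) : C := (ln (Cmod z), Carg z).

Lemma Cexp_Clog (z : C) : z <> 0 -> Cexp (Clog z) = z.
Proof.
intros Hz; assert (Hm := proj1 (Cmod_gt_0 z) Hz).
assert (H2 : (Cmod z * Cmod z = Re z * Re z + Im z * Im z)%R)
  by (generalize (Cmod2_alt z); simpl; lra).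
assert (Hb : (-1 <= Re z / Cmod z <= 1)%R).
{ apply Rabs_le_between; unfold Rdiv.
  rewrite Rabs_mult, Rabs_inv, (Rabs_pos_eq (Cmod z)) by lra.
  apply Rmult_le_reg_r with (Cmod z); [easy|].
  rewrite Rmult_assoc, Rinv_l, Rmult_1_r, Rmult_1_l by lra; apply re_le_Cmod. }
assert (Hs : sin (acos (Re z / Cmod z)) = (Rabs (Im z) / Cmod z)%R).
{ rewrite sin_acos by exact Hb.
  rewrite <- (sqrt_Rsqr (Rabs (Im z) / Cmod z)).
  - f_equal; unfold Rdiv; rewrite !Rsqr_mult, <- Rsqr_abs; unfold Rsqr.
    replace (Im z * Im z)%R with (Cmod z * Cmod z - Re z * Re z)%R by lra.
    field; lra.
  - apply Rmult_le_pos; [apply Rabs_pos | apply Rlt_le, Rinv_0_lt_compat, Hm]. }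
unfold Cexp, Clog, Carg; simpl.
rewrite exp_ln by exact Hm.
apply injective_projections; simpl;
  fold (Re z) (Im z); destruct (Rle_dec 0 (Im z)) as [Hi|Hi];
  rewrite ?cos_neg, ?sin_neg, ?cos_acos, ?Hs by exact Hb.
- field; lra.
- field; lra.
- rewrite Rabs_pos_eq by exact Hi; field; lra.
- rewrite Rabs_left by lra; field; lra.
Qed.

Lemma Carg_bound (z : C) : z <> 0 -> (- PI < Carg z <= PI)%R.
Proof.
intros Hz; generalize (acos_bound (Re z / Cmod z)) PI_RGT_0; unfold Carg.
destruct (Rle_dec 0 (Im z)) as [Hi|Hi]; intros Hb Hp; [lra|].
split; [|lra].
destruct (Req_dec (acos (Re z / Cmod z)) PI) as [He|He]; [exfalso|lra].
generalize (f_equal Im (Cexp_Clog z Hz)).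
unfold Cexp, Clog, Carg, Im at 1 2; simpl fst; simpl snd.
destruct (Rle_dec 0 (Im z)); [easy|].
rewrite He, sin_neg, sin_PI; lra.
Qed.

Definition Cpower (z w : C) : C := Cexp (w * Clog z).

(* Radius |log(-lambda)| of the disc on which the generating function is
   expanded, i.e. the distance from 0 to the nearest nonzero zero of
   t |-> lambda * e^t + 1.  There is no such zero when lambda = 0; when
   lambda = -1 the principal value log 1 = 0 would make the disc empty, and the
   nearest nonzero values of the logarithm of 1 are +-2*i*PI. *)
Definition gen_radius (lambda : C) : Rbar :=
  if Ceq_dec lambda 0 then p_infty
  else if Ceq_dec lambda (-1) then Finite (2 * PI)
  else Finite (Cmod (Clog (- lambda))).

(* The power 2^eta and the branch of t^delta are principal.  Whenever the
   right-hand side is a power series in t, alpha * delta is an integer and the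
   choice of branch of t^delta is irrelevant. *)
Definition bell_apostol_gen (alpha : nat) (lambda eta delta x1 x2 t : C) : C :=
  ((Cpower 2 eta * Cpower t delta) / (lambda * Cexp t + 1)) ^ alpha
  * Cexp (x1 * t + x2 * (Cexp t - 1)).

(* F n x1 x2 is the n-th Bell based Apostol type polynomial evaluated at
   (x1, x2).  The point t = 0 is left out because the generating function may
   have a removable singularity there (as for lambda = -1, delta = 1); by
   continuity this does not affect the coefficients. *)
Definition is_bell_apostol (alpha : nat) (lambda eta delta : C)
    (F : nat -> C -> C -> C) : Prop :=
  forall x1 x2 t : C,
    t <> 0 -> Rbar_lt (Finite (Cmod t)) (gen_radius lambda) ->
    @is_series C_AbsRing C_NormedModule
      (fun n : nat => F n x1 x2 * (t ^ n / RtoC (INR (fact n))))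
      (bell_apostol_gen alpha lambda eta delta x1 x2 t).

(* Main.v *)
Require Import Defs.
From Stdlib Require Import Reals Factorial Lra Lia.
From Coquelicot Require Import Coquelicot.

(** Multiplying the generating function by exp (h t) translates x1 by h, so the
    normalised polynomials F_n(x1) / n! form an Appell sequence:

      F_n(x1 + h) / n! = sum_(k <= n) (h^k / k!) * (F_(n-k)(x1) / (n-k)!).

    This is obtained by expanding the product exp (h t) * G(x1, t) as a Cauchy
    product and comparing coefficients ([bell_apostol_translate]).  For fixed x1
    the right-hand side is a polynomial in h, whose derivative at h = 0 is its
    coefficient of h, namely F_(n-1)(x1) / (n-1)!; multiplying by n! gives the
    formula.

    Coefficients are determined by the values at real t alone, so t is restricted
    to the real line; a series with complex coefficients is then a pair of real
    power series, for which Cauchy products and uniqueness of coefficients are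
    classical.  The point t = 0 is never used, the generating function being
    unspecified there. *)

(** * Power series of a real variable with complex coefficients *)

Local Open Scope R_scope.

(** The power series with complex coefficients [c] converges to [l] at the real
    point [t], stated componentwise. *)
Definition is_cpseries (c : nat -> C) (t : R) (l : C) : Prop :=
  is_pseries (fun n => Re (c n)) t (Re l) /\
  is_pseries (fun n => Im (c n)) t (Im l).

Lemma sum_n_Re_Im (u : nat -> C) (n : nat) :
  sum_n u n = (sum_n (fun k => Re (u k)) n, sum_n (fun k => Im (u k)) n).
Proof.
induction n as [|n IH]; [rewrite !sum_O; apply surjective_pairing|].
rewrite !sum_Sn, IH; easy.
Qed.

Lemma is_series_Re_Im (u : nat -> C) (l : C) :
  @is_series C_AbsRing C_NormedModule u l ->
  is_series (fun n => Re (u n)) (Re l) /\ is_series (fun n => Im (u n)) (Im l).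
Proof.
intros H; split;
  (eapply filterlim_ext; [|eapply filterlim_comp; [exact H|]]).
2: apply (continuous_fst (U := R_UniformSpace) (V := R_UniformSpace)).
3: apply (continuous_snd (U := R_UniformSpace) (V := R_UniformSpace)).
- exact (fun n => f_equal fst (sum_n_Re_Im u n)).
- exact (fun n => f_equal snd (sum_n_Re_Im u n)).
Qed.

Lemma is_series_cpseries (c : nat -> C) (t : R) (l : C) :
  @is_series C_AbsRing C_NormedModule (fun n => c n * RtoC t ^ n)%C l ->
  is_cpseries c t l.
Proof.
intros H; destruct (is_series_Re_Im _ _ H) as [Hr Hi].
split; apply is_pseries_R; eapply is_series_ext; [|exact Hr | |exact Hi];
  intros n; simpl; rewrite <- RtoC_pow; unfold Re, Im; simpl; ring.
Qed.

(** Convergence is assumed away from 0 only, and gives strict inclusion in the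
    disc of convergence because the point (|t| + r) / 2 is also a point of
    convergence. *)
Lemma lt_CV_radius (a : nat -> R) (r t : R) :
  (forall s, s <> 0 -> Rabs s < r -> ex_pseries a s) ->
  Rabs t < r -> Rbar_lt (Rabs t) (CV_radius a).
Proof.
intros H Ht; destruct (Rbar_lt_le_dec (Rabs t) (CV_radius a)) as [|Hle]; [easy|].
exfalso; set (s := (Rabs t + r) / 2).
assert (Hs : 0 < s) by (generalize (Rabs_pos t); unfold s; lra).
apply (CV_disk_outside a s).
- apply Rbar_le_lt_trans with (1 := Hle); simpl.
  rewrite (Rabs_pos_eq s) by lra; unfold s; lra.
- apply ex_series_lim_0, ex_pseries_R, H; [lra|].
  rewrite Rabs_pos_eq by lra; unfold s; lra.
Qed.

(** Coefficients are determined by the sum on a punctured neighbourhood of 0: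
    the two sums agree at 0 as well, by continuity. *)
Lemma pseries_coef_unique (a b : nat -> R) (f : R -> R) (r : R) :
  0 < r ->
  (forall t, t <> 0 -> Rabs t < r -> is_pseries a t (f t)) ->
  (forall t, t <> 0 -> Rabs t < r -> is_pseries b t (f t)) ->
  forall n, a n = b n.
Proof.
intros Hr Ha Hb n.
assert (Ca : forall t, Rabs t < r -> Rbar_lt (Rabs t) (CV_radius a)).
{ intros t; apply lt_CV_radius; intros s H1 H2; exists (f s); now apply Ha. }
assert (Cb : forall t, Rabs t < r -> Rbar_lt (Rabs t) (CV_radius b)).
{ intros t; apply lt_CV_radius; intros s H1 H2; exists (f s); now apply Hb. }
assert (Hab : forall t, t <> 0 -> Rabs t < r -> PSeries a t = PSeries b t).
{ intros t H1 H2.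
  now rewrite (is_pseries_unique _ _ _ (Ha t H1 H2)),
    (is_pseries_unique _ _ _ (Hb t H1 H2)). }
assert (H0 : Rabs 0 < r) by now rewrite Rabs_R0.
assert (E0 : PSeries a 0 = PSeries b 0).
{ assert (L : forall c, (forall t, Rabs t < r -> Rbar_lt (Rabs t) (CV_radius c)) ->
    is_lim (PSeries c) 0 (PSeries c 0)).
  { intros c Hc; now apply is_lim_continuity, PSeries_continuity, Hc. }
  assert (La := L a Ca); assert (Lb := L b Cb).
  assert (Lb' : is_lim (PSeries a) 0 (PSeries b 0)).
  { apply is_lim_ext_loc with (2 := Lb).
    exists (mkposreal r Hr); intros t Ht Hn; symmetry; apply Hab; [exact Hn|].
    unfold ball, AbsRing_ball in Ht; simpl in Ht.
    unfold AbsRing_ball, abs, minus, plus, opp in Ht; simpl in Ht.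
    now replace t with (t + - 0) by ring. }
  apply is_lim_unique in La; apply is_lim_unique in Lb'.
  rewrite La in Lb'; now injection Lb'. }
apply PSeries_ext_recip; [rewrite <- Rabs_R0; now apply Ca | rewrite <- Rabs_R0; now apply Cb|].
exists (mkposreal r Hr); intros t Ht.
destruct (Req_dec t 0) as [->|Hn]; [easy|apply Hab; [exact Hn|]].
unfold ball, AbsRing_ball in Ht; simpl in Ht.
unfold AbsRing_ball, abs, minus, plus, opp in Ht; simpl in Ht.
now replace t with (t + - 0) by ring.
Qed.

Lemma cpseries_coef_unique (c d : nat -> C) (f : R -> C) (r : R) :
  0 < r ->
  (forall t, t <> 0 -> Rabs t < r -> is_cpseries c t (f t)) ->
  (forall t, t <> 0 -> Rabs t < r -> is_cpseries d t (f t)) ->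
  forall n, c n = d n.
Proof.
intros Hr Hc Hd n; apply injective_projections.
- apply (pseries_coef_unique (fun n => Re (c n)) (fun n => Re (d n))
    (fun t => Re (f t)) r Hr); intros t H1 H2; [apply Hc|apply Hd]; easy.
- apply (pseries_coef_unique (fun n => Im (c n)) (fun n => Im (d n))
    (fun t => Im (f t)) r Hr); intros t H1 H2; [apply Hc|apply Hd]; easy.
Qed.

(** Coefficients of the Cauchy product of two complex power series. *)
Definition cps_mult (c d : nat -> C) (n : nat) : C :=
  sum_n (fun k => c k * d (n - k)%nat)%C n.

Lemma cps_mult_Re (c d : nat -> C) (n : nat) :
  Re (cps_mult c d n) =
  PS_mult (fun k => Re (c k)) (fun k => Re (d k)) n -
  PS_mult (fun k => Im (c k)) (fun k => Im (d k)) n.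
Proof.
unfold cps_mult, PS_mult; rewrite sum_n_Re_Im; simpl.
rewrite <- minus_sum, sum_n_Reals; apply sum_eq; intros k _; reflexivity.
Qed.

Lemma cps_mult_Im (c d : nat -> C) (n : nat) :
  Im (cps_mult c d n) =
  PS_mult (fun k => Re (c k)) (fun k => Im (d k)) n +
  PS_mult (fun k => Im (c k)) (fun k => Re (d k)) n.
Proof.
unfold cps_mult, PS_mult; rewrite sum_n_Re_Im; simpl.
rewrite <- plus_sum, sum_n_Reals; apply sum_eq; intros k _; reflexivity.
Qed.

Lemma is_cpseries_mult (c d : nat -> C) (f g : R -> C) (r t : R) :
  (forall s, s <> 0 -> Rabs s < r -> is_cpseries c s (f s)) ->
  (forall s, s <> 0 -> Rabs s < r -> is_cpseries d s (g s)) ->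
  t <> 0 -> Rabs t < r -> is_cpseries (cps_mult c d) t (f t * g t)%C.
Proof.
intros Hc Hd Ht0 Ht.
destruct (Hc t Ht0 Ht) as [Hcr Hci]; destruct (Hd t Ht0 Ht) as [Hdr Hdi].
assert (Ccr : Rbar_lt (Rabs t) (CV_radius (fun n => Re (c n)))).
{ apply lt_CV_radius with r; [|easy]; intros s H1 H2; eexists; now apply Hc. }
assert (Cci : Rbar_lt (Rabs t) (CV_radius (fun n => Im (c n)))).
{ apply lt_CV_radius with r; [|easy]; intros s H1 H2; eexists; now apply Hc. }
assert (Cdr : Rbar_lt (Rabs t) (CV_radius (fun n => Re (d n)))).
{ apply lt_CV_radius with r; [|easy]; intros s H1 H2; eexists; now apply Hd. }
assert (Cdi : Rbar_lt (Rabs t) (CV_radius (fun n => Im (d n)))).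
{ apply lt_CV_radius with r; [|easy]; intros s H1 H2; eexists; now apply Hd. }
split.
- eapply is_pseries_ext; [intros n; symmetry; apply cps_mult_Re|].
  apply (is_pseries_minus (K := R_AbsRing) (V := R_NormedModule));
    now apply is_pseries_mult.
- eapply is_pseries_ext; [intros n; symmetry; apply cps_mult_Im|].
  apply (is_pseries_plus (K := R_AbsRing) (V := R_NormedModule));
    now apply is_pseries_mult.
Qed.

(** * The complex exponential *)

Lemma Cexp_plus (z w : C) : Cexp (z + w)%C = (Cexp z * Cexp w)%C.
Proof.
unfold Cexp; apply injective_projections; simpl;
  rewrite exp_plus, ?cos_plus, ?sin_plus; unfold Re, Im; ring.
Qed.

(** Coefficient of t^n in the expansion of exp (h t). *)
Definition cexp_coef (h : C) (n : nat) : C := (h ^ n / RtoC (INR (fact n)))%C.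

(** Coefficient form of the differential equation E' = h E. *)
Lemma cexp_coef_S (h : C) (n : nat) :
  (RtoC (INR (S n)) * cexp_coef h (S n) = h * cexp_coef h n)%C.
Proof.
unfold cexp_coef; rewrite fact_simpl, mult_INR, RtoC_mult, Cpow_S.
field; split; intros H; apply RtoC_inj in H;
  [now apply (INR_fact_neq_0 n) | now apply (not_0_INR (S n))].
Qed.

Lemma Cmod_cexp_coef (h : C) (n : nat) :
  Cmod (cexp_coef h n) = Cmod h ^ n / INR (fact n).
Proof.
unfold cexp_coef, Rdiv; assert (H := INR_fact_neq_0 n).
rewrite Cmod_div, Cmod_pow, Cmod_R by (intros E; now apply RtoC_inj in E).
now rewrite Rabs_pos_eq by apply pos_INR.
Qed.

Lemma ex_pseries_cexp_coef (h : C) (a : nat -> R) (t : R) :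
  (forall n, Rabs (a n) <= Cmod (cexp_coef h n)) -> ex_pseries a t.
Proof.
intros Ha; apply ex_pseries_R.
apply (ex_series_le (K := R_AbsRing) (V := R_CompleteNormedModule))
  with (fun n => / INR (fact n) * (Cmod h * Rabs t) ^ n).
- intros n; change (norm (a n * t ^ n)) with (Rabs (a n * t ^ n)).
  rewrite Rabs_mult, <- RPow_abs, Rpow_mult_distr.
  replace (/ INR (fact n) * (Cmod h ^ n * Rabs t ^ n))
    with (Cmod h ^ n / INR (fact n) * Rabs t ^ n) by (unfold Rdiv; ring).
  rewrite <- Cmod_cexp_coef; apply Rmult_le_compat_r; [|apply Ha].
  apply pow_le, Rabs_pos.
- apply ex_pseries_R; eexists; apply is_exp_Reals.
Qed.

Lemma CV_radius_cexp_coef (h : C) (a : nat -> R) (t : R) :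
  (forall n, Rabs (a n) <= Cmod (cexp_coef h n)) ->
  Rbar_lt (Rabs t) (CV_radius a).
Proof.
intros Ha; apply lt_CV_radius with (Rabs t + 1); [|lra].
intros s _ _; now apply ex_pseries_cexp_coef with h.
Qed.

(** The sum E = p + i q of the exponential series satisfies E' = h E with
    E(0) = 1, so exp (- h t) * E(t) is constant, equal to 1.  With h = a + i b,
    its real and imaginary parts are exp (- a t) * (cos (b t) p + sin (b t) q) and
    exp (- a t) * (cos (b t) q - sin (b t) p). *)
Lemma is_cpseries_Cexp (h : C) (t : R) :
  is_cpseries (cexp_coef h) t (Cexp (h * RtoC t)%C).
Proof.
set (a := Re h); set (b := Im h).
set (p := fun n => Re (cexp_coef h n)); set (q := fun n => Im (cexp_coef h n)).
assert (Bp : forall n, Rabs (p n) <= Cmod (cexp_coef h n))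
  by (intros n; apply re_le_Cmod).
assert (Bq : forall n, Rabs (q n) <= Cmod (cexp_coef h n))
  by (intros n; eapply Rle_trans; [apply Rmax_r | apply Rmax_Cmod]).
assert (Ep : forall s, ex_pseries p s)
  by (intros s; now apply ex_pseries_cexp_coef with h).
assert (Eq : forall s, ex_pseries q s)
  by (intros s; now apply ex_pseries_cexp_coef with h).
assert (Dp : forall s, is_derive (PSeries p) s (a * PSeries p s - b * PSeries q s)).
{ intros s; rewrite <- !PSeries_scal.
  rewrite <- PSeries_minus by (apply ex_pseries_scal; [apply Rmult_comm | easy]).
  erewrite <- PSeries_ext;
    [apply is_derive_PSeries; now apply CV_radius_cexp_coef with h|].
  intros n; unfold PS_derive.
  assert (H := f_equal Re (cexp_coef_S h n)); simpl in H.
  unfold p, q, PS_minus, PS_plus, PS_opp, PS_scal, scal, plus, opp; simpl.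
  unfold mult; simpl; fold (Re (cexp_coef h (S n))) in H; unfold Re, Im in *.
  unfold a, b, Re, Im; lra. }
assert (Dq : forall s, is_derive (PSeries q) s (a * PSeries q s + b * PSeries p s)).
{ intros s; rewrite <- !PSeries_scal.
  rewrite <- PSeries_plus by (apply ex_pseries_scal; [apply Rmult_comm | easy]).
  erewrite <- PSeries_ext;
    [apply is_derive_PSeries; now apply CV_radius_cexp_coef with h|].
  intros n; unfold PS_derive.
  assert (H := f_equal Im (cexp_coef_S h n)); simpl in H.
  unfold p, q, PS_plus, PS_scal, scal, plus; simpl.
  unfold mult; simpl; unfold a, b, Re, Im in *; lra. }
assert (Cst : forall f, (forall s, is_derive f s 0) -> f t = f 0).
{ intros f Hf; destruct (Rtotal_order t 0) as [H|[->|H]]; [|easy|].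
  - now apply (eq_is_derive f).
  - symmetry; now apply (eq_is_derive f). }
assert (Hp : exp (- a * t) * (cos (b * t) * PSeries p t + sin (b * t) * PSeries q t) = 1).
{ rewrite (Cst (fun t =>
    exp (- a * t) * (cos (b * t) * PSeries p t + sin (b * t) * PSeries q t))).
  - rewrite !Rmult_0_r, exp_0, cos_0, sin_0, !PSeries_0.
    unfold p, cexp_coef; simpl; field.
  - intros s; auto_derive.
    + repeat split; eexists; [apply Dp | apply Dq].
    + rewrite (is_derive_unique (fun x : R => PSeries p x) _ _ (Dp s)),
        (is_derive_unique (fun x : R => PSeries q x) _ _ (Dq s)); ring. }
assert (Hq : exp (- a * t) * (cos (b * t) * PSeries q t - sin (b * t) * PSeries p t) = 0).
{ rewrite (Cst (fun t =>
    exp (- a * t) * (cos (b * t) * PSeries q t - sin (b * t) * PSeries p t))).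
  - rewrite !Rmult_0_r, exp_0, cos_0, sin_0, !PSeries_0.
    unfold q, cexp_coef; simpl; field.
  - intros s; auto_derive.
    + repeat split; eexists; [apply Dq | apply Dp].
    + rewrite (is_derive_unique (fun x : R => PSeries p x) _ _ (Dp s)),
        (is_derive_unique (fun x : R => PSeries q x) _ _ (Dq s)); ring. }
assert (He : exp (a * t) * exp (- a * t) = 1)
  by (rewrite <- exp_plus, <- exp_0; f_equal; ring).
assert (Ht := sin2_cos2 (b * t)); unfold Rsqr in Ht.
assert (H1 : cos (b * t) * PSeries p t + sin (b * t) * PSeries q t = exp (a * t)).
{ rewrite <- (Rmult_1_r (exp (a * t))), <- Hp, <- Rmult_assoc, He; ring. }
assert (H0 : cos (b * t) * PSeries q t - sin (b * t) * PSeries p t = 0).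
{ rewrite <- (Rmult_0_r (exp (a * t))), <- Hq, <- Rmult_assoc, He; ring. }
assert (Vp : PSeries p t = exp (a * t) * cos (b * t)).
{ transitivity ((sin (b * t) * sin (b * t) + cos (b * t) * cos (b * t)) * PSeries p t
    + sin (b * t) * 0); [rewrite Ht; ring | rewrite <- H1, <- H0; ring]. }
assert (Vq : PSeries q t = exp (a * t) * sin (b * t)).
{ transitivity ((sin (b * t) * sin (b * t) + cos (b * t) * cos (b * t)) * PSeries q t
    - cos (b * t) * 0); [rewrite Ht; ring | rewrite <- H1, <- H0; ring]. }
assert (Vc : Cexp (h * RtoC t)%C = (PSeries p t, PSeries q t)).
{ unfold Cexp; rewrite Vp, Vq.
  replace (Re (h * RtoC t)%C) with (a * t) by (unfold a, Re, Im; simpl; ring).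
  replace (Im (h * RtoC t)%C) with (b * t) by (unfold b, Re, Im; simpl; ring).
  reflexivity. }
rewrite Vc; split; now apply PSeries_correct.
Qed.

(** * Appell structure of the Bell based Apostol type polynomials *)

(** For lambda distinct from 0 and -1 the radius |log (- lambda)| is nonzero,
    because log (- lambda) = 0 would give - lambda = 1. *)
Lemma gen_radius_pos (lambda : C) :
  exists r, 0 < r /\ forall t, t < r -> Rbar_lt t (gen_radius lambda).
Proof.
unfold gen_radius; destruct (Ceq_dec lambda 0) as [|H0].
- exists 1; split; [lra | easy].
- destruct (Ceq_dec lambda (-1)) as [|H1].
  + exists (2 * PI); split; [generalize PI_RGT_0; lra | easy].
  + exists (Cmod (Clog (- lambda))); split; [|easy].
    apply Cmod_gt_0; intros E; apply H1.
    assert (Hn : (- lambda)%C <> 0).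
    { intros Hn; apply H0; replace lambda with (- - lambda)%C by ring.
      rewrite Hn; apply injective_projections; simpl; ring. }
    assert (Hl := Cexp_Clog _ Hn); rewrite E in Hl.
    replace lambda with (- - lambda)%C by ring; rewrite <- Hl.
    unfold Cexp; simpl; rewrite exp_0, cos_0, sin_0.
    apply injective_projections; simpl; ring.
Qed.

Lemma bell_apostol_gen_translate (alpha : nat) (lambda eta delta x1 x2 h t : C) :
  bell_apostol_gen alpha lambda eta delta (x1 + h)%C x2 t =
  (Cexp (h * t) * bell_apostol_gen alpha lambda eta delta x1 x2 t)%C.
Proof.
unfold bell_apostol_gen.
replace ((x1 + h) * t + x2 * (Cexp t - 1))%C
  with (h * t + (x1 * t + x2 * (Cexp t - 1)))%C by ring.
rewrite Cexp_plus; ring.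
Qed.

(** The Appell identity: x1 |-> F_n(x1) / n! is expanded around any point. *)
Lemma bell_apostol_translate (alpha : nat) (lambda eta delta : C)
  (F : nat -> C -> C -> C) (x1 x2 h : C) (n : nat) :
  is_bell_apostol alpha lambda eta delta F ->
  (F n (x1 + h) x2 / RtoC (INR (fact n)) =
  cps_mult (cexp_coef h) (fun k => F k x1 x2 / RtoC (INR (fact k))) n)%C.
Proof.
intros HF; destruct (gen_radius_pos lambda) as [r [Hr Hlt]].
assert (HS : forall x t, t <> 0 -> Rabs t < r ->
  is_cpseries (fun k => F k x x2 / RtoC (INR (fact k)))%C t
    (bell_apostol_gen alpha lambda eta delta x x2 (RtoC t))).
{ intros x t H1 H2; apply is_series_cpseries.
  eapply is_series_ext; [|apply (HF x x2 (RtoC t))].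
  - intros k; simpl; unfold Cdiv; ring.
  - intros E; now apply RtoC_inj in E.
  - apply Hlt; now rewrite Cmod_R. }
apply (cpseries_coef_unique
  (fun k => F k (x1 + h) x2 / RtoC (INR (fact k)))%C _
  (fun t => bell_apostol_gen alpha lambda eta delta (x1 + h)%C x2 (RtoC t)) r Hr).
- intros t; apply HS.
- intros t H1 H2; rewrite bell_apostol_gen_translate.
  apply is_cpseries_mult with (r := r)
    (f := fun t => Cexp (h * RtoC t)%C)
    (g := fun t => bell_apostol_gen alpha lambda eta delta x1 x2 (RtoC t)); try easy.
  + intros s _ _; apply is_cpseries_Cexp.
  + intros s; apply HS.
Qed.

Local Open Scope C_scope.

(** The two normed module structures carried by C over itself have different
    uniform structures, but the derivative depends only on their common norm. *)
Lemma is_derive_C_AbsRing (f : C -> C) (x l : C) :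
  @is_derive C_AbsRing C_NormedModule f x l <->
  @is_derive C_AbsRing (AbsRing_NormedModule C_AbsRing) f x l.
Proof.
split; intros [[Hp Hs Hn] H];
  (split; [constructor; [exact Hp|exact Hs|exact Hn] | exact H]).
Qed.

Lemma is_derive_sub_mult (g : C -> C) (x l : C) :
  @is_derive C_AbsRing C_NormedModule g x l ->
  @is_derive C_AbsRing C_NormedModule (fun y => (y - x) * g y) x (g x).
Proof.
intros Hg; apply is_derive_C_AbsRing.
replace (g x) with (1 * g x + (x - x) * l) by ring.
apply (@is_derive_mult C_AbsRing (fun y => y - x) g x (RtoC 1) l).
- replace (RtoC 1) with (1 - 0) by ring.
  apply (@is_derive_minus C_AbsRing (AbsRing_NormedModule C_AbsRing)).
  + apply (@is_derive_id C_AbsRing).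
  + apply (@is_derive_const C_AbsRing (AbsRing_NormedModule C_AbsRing)).
- now apply is_derive_C_AbsRing.
- intros u v; apply Cmult_comm.
Qed.

Lemma is_derive_sub_pow (x c : C) (k : nat) :
  @is_derive C_AbsRing C_NormedModule (fun y => (y - x) ^ k * c) x
    (match k with 1%nat => c | _ => RtoC 0 end).
Proof.
assert (H0 : @is_derive C_AbsRing C_NormedModule (fun y => (y - x) ^ 0 * c) x (RtoC 0)).
{ exact (@is_derive_const C_AbsRing C_NormedModule (1 * c) x). }
assert (HS : forall k l, @is_derive C_AbsRing C_NormedModule (fun y => (y - x) ^ k * c) x l ->
  @is_derive C_AbsRing C_NormedModule (fun y => (y - x) ^ S k * c) x ((x - x) ^ k * c)).
{ intros j l Hj; eapply is_derive_ext; [|exact (is_derive_sub_mult _ x l Hj)].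
  exact (fun y => Cmult_assoc (y - x) ((y - x) ^ j) c). }
induction k as [|k IH]; [exact H0|].
assert (Hk := HS k _ IH); destruct k as [|k].
- replace ((x - x) ^ 0 * c) with c in Hk by (simpl; ring); exact Hk.
- replace ((x - x) ^ S k * c) with (RtoC 0) in Hk by (rewrite Cpow_S; ring); exact Hk.
Qed.

Lemma sum_n_single (u : nat -> C) (n j : nat) :
  (forall k, k <> j -> u k = 0) -> (j <= n)%nat -> sum_n u n = u j.
Proof.
intros Hu; induction n as [|n IH]; intros Hj.
- rewrite sum_O; f_equal; lia.
- rewrite sum_Sn; destruct (Nat.eq_dec j (S n)) as [->|Hn].
  + assert (Z : forall m, (m <= n)%nat -> sum_n u m = RtoC 0).
    { intros m; induction m as [|m IHm]; intros Hm.
      - rewrite sum_O; apply Hu; lia.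
      - rewrite sum_Sn, IHm, (Hu (S m)) by lia; now apply Cplus_0_l. }
    rewrite Z by lia; now apply Cplus_0_l.
  + rewrite IH, (Hu (S n)) by lia; apply Cplus_0_r.
Qed.

Theorem theorem4p1 (alpha : nat) (lambda eta delta : C)
  (F : nat -> C -> C -> C)
  (HF : is_bell_apostol alpha lambda eta delta F)
  (n : nat) (hn : (1 <= n)%nat) (x1 x2 : C) :
  is_derive (fun x : C => F n x x2) x1 (RtoC (INR n) * F (n - 1)%nat x1 x2).
Proof.
set (N := RtoC (INR (fact n))).
assert (Hf : forall k, RtoC (INR (fact k)) <> 0)
  by (intros k E; apply RtoC_inj in E; now apply (INR_fact_neq_0 k)).
(* c k is the coefficient of (x - x1)^k in F n x x2, and d k the derivative at
   x1 of the corresponding term. *)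
set (c := fun k => F (n - k)%nat x1 x2 / RtoC (INR (fact (n - k)))
  / RtoC (INR (fact k)) * N).
set (d := fun k => match k with 1%nat => c 1%nat | _ => RtoC 0 end).
replace (RtoC (INR n) * F (n - 1)%nat x1 x2) with (sum_n d n).
- eapply is_derive_ext;
    [|apply (is_derive_sum_n (V := C_NormedModule) (fun k x => (x - x1) ^ k * c k))].
  + intros x; change C in (type of x); cbv beta.
    transitivity (N * cps_mult (cexp_coef (x - x1))
      (fun k => F k x1 x2 / RtoC (INR (fact k))) n).
    * unfold cps_mult; rewrite <- (sum_n_mult_l (K := C_Ring)).
      apply sum_n_ext; intros k.
      change ((x - x1) ^ k * c k = N * (cexp_coef (x - x1) k
        * (F (n - k)%nat x1 x2 / RtoC (INR (fact (n - k)))))).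
      unfold cexp_coef, c; field; auto.
    * rewrite <- (bell_apostol_translate alpha lambda eta delta F) by exact HF.
      replace (x1 + (x - x1)) with x by ring.
      change (N * (F n x x2 / N) = F n x x2); field; apply Hf.
  + intros k Hk; destruct k as [|[|k]]; apply is_derive_sub_pow.
- rewrite (sum_n_single d n 1%nat); [|intros [|[|k]]; easy|exact hn].
  change (c 1%nat = RtoC (INR n) * F (n - 1)%nat x1 x2); unfold c, N.
  destruct n as [|m]; [lia|]; simpl (S m - 1)%nat.
  change (INR (fact 1)) with 1%R.
  rewrite Nat.sub_0_r, fact_simpl, mult_INR, RtoC_mult; field; apply Hf.
Qed.
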